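(* Let $k$ be a field of prime characteristic $p>0$, let $M\cong\mathbb{Z}^d$ be a free abelian group of rank $d$, let $S\subset M$ be a finitely generated submonoid that generates $M$ as a group, and suppose $R=k[S]$ is normal. Let $\sigma^\vee=\operatorname{cone}(S)\subset M\otimes_{\mathbb{Z}}\mathbb{R}$. Let $I=(x^{\mathbf b}\mid\mathbf b\in\mathcal{B})$ and $\mathfrak{a}=(x^{\mathbf a}\mid\mathbf a\in\mathcal{A})$ be monomial ideals of $R$, with $\mathcal{A},\mathcal{B}\subset S$ finite, let $H$ be the convex hull of $\mathcal{A}$, and let $t\in\mathbb{R}_{>0}$. For a monomial $x^{\mathbf v}\in R$ we have: (a) $x^{\mathbf v}\in I^{F\mathfrak{a}^t}$ if and only if $x^{\mathbf v}\in I^{*\mathfrak{a}^t}$ if and only if $\mathbf v+tH\subset\mathcal{B}+\sigma^\vee$; (b) $x^{\mathbf v}\in{}^{\mathfrak{a}^t}I^*$ if and only if $\mathbf v+tH\subset\mathcal{B}+tH+\sigma^\vee$; (c) if $x^{\mathbf v}\in{}^{\mathfrak{a}^t}I^F$, then $\mathbf v+tH\subset\mathcal{B}+tH+\sigma^\vee$; and (d) if there exists $s>t$ such that $\mathbf v+tH\subset\mathcal{B}+sH+\sigma^\vee$, then $x^{\mathbf v}\in{}^{\mathfrak{a}^t}I^F$.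
   Context: $x^{\mathbf v}$ ($\mathbf v\in S$) denotes the monomial of $k[S]$ with exponent $\mathbf v$. $\operatorname{cone}(S)$ is the set of non-negative real linear combinations of elements of $S$. Sums of sets are Minkowski sums. ($k[S]$ is normal exactly when $S=\sigma^\vee\cap M$.) $R^\circ$ is the set of elements of $R$ not in any minimal prime, i.e. the nonzero elements here. $I^{[p^e]}$ is the ideal generated by $\{r^{p^e}\mid r\in I\}$. Definitions: $$I^{*\mathfrak{a}^t}=\{x\in R\mid\text{for some }c\in R^\circ\text{ and all }e\gg0,\ cx^{p^e}\mathfrak{a}^{\lceil tp^e\rceil}\subset I^{[p^e]}\},$$ $${}^{\mathfrak{a}^t}I^*=\{x\in R\mid\text{for some }c\in R^\circ\text{ and all }e\gg0,\ cx^{p^e}\mathfrak{a}^{\lceil tp^e\rceil}\subset\mathfrak{a}^{\lceil tp^e\rceil}I^{[p^e]}\},$$ $$I^{F\mathfrak{a}^t}=\{x\in R\mid\text{for all }e\gg0,\ x^{p^e}\mathfrak{a}^{\lceil tp^e\rceil}\subset I^{[p^e]}\},$$ $${}^{\mathfrak{a}^t}I^F=\{x\in R\mid\text{for all }e\gg0,\ x^{p^e}\mathfrak{a}^{\lceil tp^e\rceil}\subset\mathfrak{a}^{\lceil tp^e\rceil}I^{[p^e]}\}.$$ *)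

(* Defs.v *)
From HB Require Import structures.
From mathcomp Require Import all_boot all_order all_algebra finmap.
From mathcomp Require Import boolp classical_sets reals.
From mathcomp Require Import monalg.

Set Implicit Arguments.
Unset Strict Implicit.
Unset Printing Implicit Defensive.

Import Order.TTheory GRing.Theory Num.Theory.

Local Open Scope classical_set_scope.
Local Open Scope ring_scope.

(* {malg k[N]} carries a ring structure in the library only when N has no
   nontrivial units (monomType). A submonoid of Z^d may have units, so the
   convolution product is redefined here for an arbitrary commutative
   monoid N, on a copy of {malg k[N]} that keeps its module structure. *)
Section MonoidAlgebra.
Variables (k : comNzRingType) (N : nmodType).

Definition monoid_algebra : Type := {malg k[N]}.

HB.instance Definition _ := GRing.Lmodule.on monoid_algebra.

Implicit Types (f g h : monoid_algebra) (u v w : N).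

Definition monom v : monoid_algebra := << 1 *g v >>.

Definition monalg_mul f g : monoid_algebra :=
  \sum_(u <- msupp f) \sum_(v <- msupp g) << f@_u * g@_v *g u + v >>.

Lemma monalg_mulEw (D E : {fset N}) f g :
  (msupp f `<=` D)%fset -> (msupp g `<=` E)%fset ->
  monalg_mul f g =
    \sum_(u <- D) \sum_(v <- E) (<< f@_u * g@_v *g u + v >> : {malg k[N]}).
Proof.
move=> fD gE; rewrite /monalg_mul (big_fset_incl _ fD) /=.
  apply/eq_bigr => u _; apply/big_fset_incl => // v _ /mcoeff_outdom ->.
  by rewrite mulr0 monalgU0.
move=> u _ /mcoeff_outdom fu.
by rewrite big1 // => v _; rewrite fu mul0r monalgU0.
Qed.

Lemma monalg_mulC : commutative monalg_mul.
Proof.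
move=> f g; rewrite /monalg_mul exchange_big /=.
by apply/eq_bigr => v _; apply/eq_bigr => u _; rewrite mulrC addrC.
Qed.

Lemma monalg_mulDl : left_distributive monalg_mul +%R.
Proof.
move=> f g h.
rewrite (monalg_mulEw (msuppD_le f g) (fsubset_refl (msupp h))).
rewrite (monalg_mulEw (fsubsetUl (msupp f) (msupp g)) (fsubset_refl (msupp h))).
rewrite (monalg_mulEw (fsubsetUr (msupp f) (msupp g)) (fsubset_refl (msupp h))).
rewrite -big_split /=; apply/eq_bigr => u _.
rewrite -big_split /=; apply/eq_bigr => v _.
by rewrite mcoeffD mulrDl monalgUD.
Qed.

Lemma monalg_mulDr : right_distributive monalg_mul +%R.
Proof. by move=> f g h; rewrite !(monalg_mulC f) monalg_mulDl. Qed.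

Lemma monalg_mul0 : left_zero 0 monalg_mul.
Proof. by move=> f; rewrite /monalg_mul msupp0 big_seq_fset0. Qed.

Lemma monalg_mulUU a b u v :
  monalg_mul << a *g u >> << b *g v >> = << a * b *g u + v >>.
Proof.
by rewrite (monalg_mulEw msuppU_le msuppU_le) !big_seq_fset1 !mcoeffUU.
Qed.

Lemma monalg_mul_suml (s : seq N) (F : N -> monoid_algebra) g :
  monalg_mul (\sum_(i <- s) F i) g = \sum_(i <- s) monalg_mul (F i) g.
Proof.
exact: (big_morph (monalg_mul^~ g) (fun _ _ => monalg_mulDl _ _ _)
  (monalg_mul0 g)).
Qed.

Lemma monalg_mul_sumr (s : seq N) (F : N -> monoid_algebra) g :
  monalg_mul g (\sum_(i <- s) F i) = \sum_(i <- s) monalg_mul g (F i).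
Proof.
rewrite monalg_mulC monalg_mul_suml; apply/eq_bigr => i _.
exact: monalg_mulC.
Qed.

Lemma monalg_sum f :
  exists (s : seq N) (c : N -> k), f = \sum_(u <- s) << c u *g u >>.
Proof. by exists (msupp f), (mcoeff^~ f); apply: monalgE. Qed.

Lemma monalg_mulA : associative monalg_mul.
Proof.
move=> f g h; have [s [a ->]] := monalg_sum f.
have [s' [b ->]] := monalg_sum g; have [s'' [c ->]] := monalg_sum h.
rewrite !(monalg_mul_suml s); apply/eq_bigr => u _.
rewrite (monalg_mul_suml s') !(monalg_mul_sumr s') (monalg_mul_suml s').
apply/eq_bigr => v _; rewrite !(monalg_mul_sumr s''); apply/eq_bigr => w _.
by rewrite !monalg_mulUU mulrA addrA.
Qed.

Lemma monalg_mul1 : left_id (monom 0) monalg_mul.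
Proof.
move=> f; have [s [a ->]] := monalg_sum f.
rewrite monalg_mul_sumr; apply/eq_bigr => v _.
by rewrite monalg_mulUU mul1r add0r.
Qed.

Lemma monom0_neq0 : monom 0 != 0.
Proof. by rewrite /monom monalgU_eq0 oner_eq0. Qed.

Lemma mcoeff_mul_unique f g u v : u \in msupp f -> v \in msupp g ->
  (forall x y, x \in msupp f -> y \in msupp g -> x + y = u + v ->
     x = u /\ y = v) ->
  (monalg_mul f g)@_(u + v) = f@_u * g@_v.
Proof.
move=> uf vg uniq; rewrite /monalg_mul raddf_sum (big_fsetD1 u uf) /=.
rewrite raddf_sum (big_fsetD1 v vg) /= mcoeffUU big1_fset => [|y].
  rewrite addr0 big1_fset ?addr0 // => x.
  rewrite in_fsetD1 => /andP[/eqP xu xf] _.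
  rewrite raddf_sum big1_fset // => y yg _ /=; rewrite mcoeffU.
  by case: eqP => // /(uniq _ _ xf yg)[].
rewrite in_fsetD1 => /andP[/eqP yv yg] _; rewrite mcoeffU.
by case: eqP => // /(uniq _ _ uf yg)[].
Qed.

HB.instance Definition _ := GRing.Zmodule_isComNzRing.Build monoid_algebra
  monalg_mulA monalg_mulC monalg_mul1 monalg_mulDl monom0_neq0.

End MonoidAlgebra.

Arguments monom k {N} v.

(* A submonoid of V is an addrClosed predicate on V; this is its carrier. *)
Section Submonoid.
Variables (V : nmodType) (S : addrClosed V).

Record submonoid : predArgType :=
  Submonoid { submonoid_val :> V; _ : submonoid_val \in S }.

HB.instance Definition _ := [isSub for submonoid_val].
HB.instance Definition _ := [Choice of submonoid by <:].

Lemma submonoid_closed : addr_closed [in S].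
Proof. by split; [apply: rpred0 | move=> x y; apply: rpredD]. Qed.

HB.instance Definition _ :=
  GRing.SubChoice_isSubNmodule.Build V [in S] submonoid submonoid_closed.

End Submonoid.

(* A translation-invariant total order on Z^d, used to show that k[S] is a
   domain. *)
Section Lex.
Variable d : nat.
Implicit Types u v w : 'rV[int]_d.

Definition lexlt u v : Prop :=
  exists2 i : 'I_d, forall j : 'I_d, (j < i)%N -> u 0 j = v 0 j & u 0 i < v 0 i.

Lemma lexlt_total u v : u <> v -> lexlt u v \/ lexlt v u.
Proof.
move=> uv.
have [i0 Pi0] : exists i, u 0 i != v 0 i.
  apply: contra_notP uv => /forallNP uv; apply/rowP => i.
  by apply/eqP; apply: contra_notT (uv i).
case: (@arg_minnP _ i0 (fun i => u 0 i != v 0 i) (@nat_of_ord d) Pi0) => i Pi mi.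
have eqj (j : 'I_d) : (j < i)%N -> u 0 j = v 0 j.
  move=> ji; apply/eqP; apply: contraLR ji => /mi; by rewrite -leqNgt.
case: (ltgtP (u 0 i) (v 0 i)) => h; last by rewrite h eqxx in Pi.
- by left; exists i.
- by right; exists i => // j /eqj.
Qed.

Lemma lexlt_trans v u w : lexlt u v -> lexlt v w -> lexlt u w.
Proof.
move=> [i ei li] [j ej lj]; case: (ltngtP i j) => ij.
- exists i; last by rewrite -(ej i ij).
  by move=> l il; rewrite ei // ej // (ltn_trans il ij).
- exists j; last by rewrite (ei j ij).
  by move=> l il; rewrite ei ?ej // (ltn_trans il ij).
- have {ij} ij : i = j by apply/val_inj.
  subst j; exists i; last exact: lt_trans lj.
  by move=> l il; rewrite ei ?ej.
Qed.

Lemma lexlt_irr u : ~ lexlt u u.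
Proof. by case=> i _; rewrite ltxx. Qed.

Lemma lexltD u v u' v' : lexlt u v -> u' = v' \/ lexlt u' v' ->
  lexlt (u + u') (v + v').
Proof.
have addl a b c : lexlt a b -> lexlt (a + c) (b + c).
  case=> i ei li; exists i; last by rewrite !mxE ltrD2r.
  by move=> j ji; rewrite !mxE ei.
move=> uv [->|uv']; first exact: addl.
apply: lexlt_trans (addl _ _ u' uv) _.
by rewrite !(addrC v); apply: addl.
Qed.

Lemma lexlt_max (s : seq 'rV[int]_d) : s != [::] ->
  exists2 m, m \in s & forall x, x \in s -> x = m \/ lexlt x m.
Proof.
elim: s => // a s IH _; have [->|s0] := eqVneq s [::].
  by exists a; rewrite ?inE // => x; rewrite inE => /eqP; left.
have [m ms mP] := IH s0.
have [->|/eqP am] := eqVneq a m.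
  exists m; first by rewrite inE eqxx.
  by move=> x; rewrite inE => /predU1P[|/mP]; [left|].
have [alm|mla] := lexlt_total am.
  exists m; first by rewrite inE ms orbT.
  by move=> x; rewrite inE => /predU1P[->|/mP]; [right|].
exists a; first by rewrite inE eqxx.
move=> x; rewrite inE => /predU1P[|/mP[->|xm]]; [by left|by right|right].
exact: lexlt_trans mla.
Qed.

End Lex.

Section SemigroupRing.
Variables (k : fieldType) (d : nat) (S : addrClosed 'rV[int]_d).

Definition semigroup_ring : Type := monoid_algebra k (submonoid S).

HB.instance Definition _ := GRing.ComNzRing.on semigroup_ring.
HB.instance Definition _ := GRing.Lmodule.on semigroup_ring.

Implicit Types f g : semigroup_ring.

Lemma semigroup_ring_lead f : f != 0 -> exists2 m, m \in msupp f &
  forall x, x \in msupp f -> x = m \/ lexlt (val x) (val m).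
Proof.
move=> f0.
have s0 : [seq val x | x <- msupp f] != [::].
  apply: contraNneq f0 => /eqP; rewrite -size_eq0 size_map size_eq0 => /eqP e.
  apply/eqP/malgP => u; rewrite mcoeff0; apply/eqP.
  by rewrite mcoeff_eq0 -[_ \in _]/(u \in enum_fset _) e.
have [_ /mapP[m ms ->] mP] := lexlt_max s0.
exists m => // x xs; have [/val_inj|] := mP _ (map_f val xs); by [left|right].
Qed.

Lemma semigroup_ring_mulf_eq0 f g : f * g = 0 -> (f == 0) || (g == 0).
Proof.
move=> fg0; apply: contraT; rewrite negb_or => /andP[f0 g0].
have [u us uP] := semigroup_ring_lead f0.
have [v vs vP] := semigroup_ring_lead g0.
have : monalg_mul f g = 0 by [].
move=> /(congr1 (mcoeff (u + v))); rewrite mcoeff_mul_unique // => [|x y xs ys].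
  by move/eqP; rewrite mcoeff0 mulf_eq0 !mcoeff_eq0 us vs.
move=> /(congr1 val) e.
have {}e : val x + val y = val u + val v by [].
have [xu|lx] := uP x xs.
  by split=> //; move: e; rewrite xu => /addrI /val_inj.
exfalso; apply: (@lexlt_irr _ (val u + val v)); rewrite -{1}e.
by apply: lexltD => //; have [->|] := vP y ys; [left|right].
Qed.

Let is_unit : pred semigroup_ring := fun f => `[< exists g, g * f = 1 >].

Let inverse f : semigroup_ring :=
  if pselect (exists g, g * f = 1) is left ex then projT1 (cid ex) else f.

Let inverseVx : {in is_unit, left_inverse 1 inverse *%R}.
Proof.
move=> f /asboolP ex; rewrite /inverse; case: pselect => // ex'.
by case: cid.
Qed.

Let is_unitPl f g : g * f = 1 -> is_unit f.
Proof. by move=> gf; apply/asboolP; exists g. Qed.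

Let inverse_out : {in [predC is_unit], inverse =1 id}.
Proof.
move=> f; rewrite inE /= => /asboolP nex; rewrite /inverse.
by case: pselect.
Qed.

HB.instance Definition _ := GRing.ComNzRing_hasMulInverse.Build semigroup_ring
  inverseVx is_unitPl inverse_out.
HB.instance Definition _ := GRing.ComUnitRing_isIntegral.Build semigroup_ring
  semigroup_ring_mulf_eq0.

End SemigroupRing.

Definition normal_domain (R : idomainType) : Prop :=
  forall z : {fraction R},
    integralOver (@FracField.tofrac R) z -> exists r : R, z = FracField.tofrac r.

Definition fin_gen_submonoid (V : nmodType) (S : addrClosed V) : Prop :=
  exists G : {fset V}, forall v : V,
    v \in S <-> exists c : V -> nat, v = \sum_(g <- G) g *+ c g.

Definition generates_group (V : zmodType) (S : addrClosed V) : Prop :=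
  forall v : V, exists (n : nat) (s : 'I_n -> V) (c : 'I_n -> int),
    (forall i, s i \in S) /\ v = \sum_i s i *~ c i.

Section Ideals.
Variable R : comNzRingType.
Implicit Types (I J P : set R) (c x : R).

Definition ideal I : Prop :=
  [/\ I 0, forall x y, I x -> I y -> I (x + y) & forall r x, I x -> I (r * x)].

Definition ideal_gen (X : set R) : set R := smallest ideal X.

Definition ideal_mul I J : set R := ideal_gen [set x * y | x in I & y in J].

Definition ideal_pow I (n : nat) : set R := iter n (ideal_mul I) setT.

Definition prime_ideal P : Prop :=
  [/\ ideal P, ~ P 1 & forall x y, P (x * y) -> P x \/ P y].

Definition minimal_prime P : Prop :=
  prime_ideal P /\ forall Q, prime_ideal Q -> Q `<=` P -> Q = P.

(* R^circ *)
Definition non_minimal_prime : set R :=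
  [set c | forall P, minimal_prime P -> ~ P c].

(* I^[p^e] *)
Definition frobenius_power (p : nat) I (e : nat) : set R :=
  ideal_gen [set r ^+ (p ^ e) | r in I].

End Ideals.

Section Closures.
Variables (R : comNzRingType) (K : realType) (p : nat).
Implicit Types (I a : set R) (t : K).

(* a^(ceil(t p^e)); the closures below are only used with t > 0, where the
   absolute value does nothing. *)
Definition real_pow a t (e : nat) : set R :=
  ideal_pow a `|Num.ceil (t * (p ^ e)%:R)|%N.

(* I^{* a^t} *)
Definition tight_closure a t I : set R :=
  [set x | exists2 c, non_minimal_prime c &
    exists e0, forall e, (e0 <= e)%N ->
      [set c * x ^+ (p ^ e) * y | y in real_pow a t e]
        `<=` frobenius_power p I e].

(* ^{a^t} I^* *)
Definition left_tight_closure a t I : set R :=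
  [set x | exists2 c, non_minimal_prime c &
    exists e0, forall e, (e0 <= e)%N ->
      [set c * x ^+ (p ^ e) * y | y in real_pow a t e]
        `<=` ideal_mul (real_pow a t e) (frobenius_power p I e)].

(* I^{F a^t} *)
Definition frobenius_closure a t I : set R :=
  [set x | exists e0, forall e, (e0 <= e)%N ->
      [set x ^+ (p ^ e) * y | y in real_pow a t e]
        `<=` frobenius_power p I e].

(* ^{a^t} I^F *)
Definition left_frobenius_closure a t I : set R :=
  [set x | exists e0, forall e, (e0 <= e)%N ->
      [set x ^+ (p ^ e) * y | y in real_pow a t e]
        `<=` ideal_mul (real_pow a t e) (frobenius_power p I e)].

End Closures.

Definition monomial_ideal (k : fieldType) (d : nat) (S : addrClosed 'rV[int]_d)
    (B : {fset submonoid S}) : set (semigroup_ring k S) :=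
  ideal_gen [set monom k b | b in [set` B]].

Arguments monomial_ideal k {d S} B.

Section Convex.
Variables (K : realType) (V : lmodType K).
Implicit Types X Y : set V.

Definition cone X : set V :=
  [set w | exists (n : nat) (x : 'I_n -> V) (c : 'I_n -> K),
    [/\ forall i, X (x i), forall i, 0 <= c i & w = \sum_i c i *: x i]].

Definition convex_hull X : set V :=
  [set w | exists (n : nat) (x : 'I_n -> V) (c : 'I_n -> K),
    [/\ forall i, X (x i), forall i, 0 <= c i, \sum_i c i = 1
      & w = \sum_i c i *: x i]].

Definition minkowski X Y : set V := [set x + y | x in X & y in Y].

Definition dilate (t : K) X : set V := [set t *: x | x in X].

End Convex.

Notation "X <+> Y" := (minkowski X Y)
  (at level 50, left associativity) : classical_set_scope.
Notation "t <*:> X" := (dilate t X)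
  (at level 40, left associativity) : classical_set_scope.

(* The embedding of M = Z^d in M (x) R = R^d. *)
Definition realify (K : realType) (d : nat) (v : 'rV[int]_d) : 'rV[K]_d :=
  map_mx intr v.

(* Main.v *)
Require Import Defs.
From HB Require Import structures.
From mathcomp Require Import all_boot all_order all_algebra finmap.
From mathcomp Require Import boolp classical_sets reals.
From mathcomp Require Import monalg ring lra zify.

Set Implicit Arguments.
Unset Strict Implicit.
Unset Printing Implicit Defensive.

Import Order.TTheory GRing.Theory Num.Theory.

Local Open Scope classical_set_scope.
Local Open Scope ring_scope.

(** Write q = p^e and n = ceil(tq), and identify a monomial with its exponent.
Since I and a are monomial ideals and Frobenius is additive in characteristic
p, the ideals a^n, I^[q] and a^n I^[q] are again monomial; their generators
have exponents in the n-fold sumset nA, in qB and in nA + qB. Each of the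
four closures thus becomes a divisibility question about the exponents
u + qv + w with w in nA, where u is any exponent that occurs in the multiplier
c (u = 0 for the Frobenius versions): such an exponent must lie in qB + S,
respectively in nA + qB + S.

Normality turns divisibility in S into a convexity question: an integer vector
in the real cone over S lies in S ([cone_saturated]). Indeed Farkas' lemma
over the rationals puts the vector in the rational cone, so a positive
multiple of it is in S, and its monomial, a quotient of two elements of k[S],
is integral over k[S].

From the closures to the geometric conditions ([hull_sub_of_exponents]): for h
in H, the point qth is, up to a bounded error, an element w of nA plus an
element of the cone. After division by q, the divisibility conditions say that
v + th + u'/q lies in Q for a fixed u' and all large q, where Q is
B + cone or B + tH + cone. As Q is a finite union of polyhedra it
is closed along the ray through u' ([ray_closed]), so v + th lies in Q.

From the geometric conditions to the closures: an element w of nA is n h with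
h in H, and v + th = b + s for (a), or v + th = b + s'h' + s for (b) and (d),
with s in the cone and s' >= t. As n >= qt, the surplus (n - qt) h lies in the
cone, so qv + w - qb is q s'h' plus an element of the cone. This settles (a)
at once. Otherwise q s'h' must be rounded down to an element of nA
([round_fset_sum]), which works as soon as the coefficients sum to at least
n + #A. For s' > t this holds once q is large; for s' = t the missing amount is
bounded independently of q and is supplied by a monomial multiplier c, which
tight closure permits and Frobenius closure does not. Finally (c) follows from
(b), the Frobenius version being the case c = 1 of the tight version. *)

(** * Linear forms and Farkas' lemma *)

Section LinearForms.
Variables (F : numDomainType) (n : nat).
Implicit Types (x y : 'rV[F]_n) (l : 'cV[F]_n).

Definition linform l x : F := (x *m l) 0 0.

Lemma linformD l x y : linform l (x + y) = linform l x + linform l y.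
Proof. by rewrite /linform mulmxDl [LHS]mxE. Qed.

Lemma linformZ l c x : linform l (c *: x) = c * linform l x.
Proof. by rewrite /linform -scalemxAl [LHS]mxE. Qed.

Lemma linform_sum l (I : Type) (s : seq I) (P : pred I) (f : I -> 'rV[F]_n) :
  linform l (\sum_(i <- s | P i) f i) = \sum_(i <- s | P i) linform l (f i).
Proof. by rewrite /linform mulmx_suml summxE. Qed.

End LinearForms.

Section Farkas.
Variables (F : realFieldType) (n : nat) (T : eqType).

(** Induction on the generators. If the form [l] separating [x] from the cone of
the other generators is negative on the new one, project everything along the
new generator onto the kernel of [l]: a nonnegative combination lifts back with
a nonnegative coefficient on the new generator, and a separating form pulls
back to one vanishing there. The ordered field is arbitrary because the lemma
is needed both over the rationals, for integrality, and over the reals, for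
closedness. *)
Lemma farkas (s : seq T) (g : T -> 'rV[F]_n) (x : 'rV[F]_n) : uniq s ->
  (exists2 c : T -> F, forall i, 0 <= c i & x = \sum_(i <- s) c i *: g i) \/
  (exists2 l : 'cV[F]_n, {in s, forall i, 0 <= linform l (g i)}
     & linform l x < 0).
Proof.
elim: s g x => [|i0 s IH] g x /=.
  move=> _; have [->|x0] := eqVneq x 0.
    by left; exists (fun=> 0) => //; rewrite big_nil.
  (* the empty cone is [0], and [- x^T] is negative on any nonzero [x] *)
  right; exists (- x^T) => //; rewrite /linform mulmxN !mxE oppr_lt0 lt0r.
  apply/andP; split; last by apply: sumr_ge0 => j _; rewrite mxE sqr_ge0.
  apply: contra_neq x0 => /eqP; rewrite psumr_eq0 => [/allP x0|j _]; last first.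
    by rewrite mxE sqr_ge0.
  apply/rowP => j; apply/eqP; have := x0 j (mem_index_enum j).
  by rewrite !mxE mulf_eq0 orbb.
move=> /andP[i0s us].
have sum_s (c : T -> F) b :
    \sum_(i <- i0 :: s) (if i == i0 then b else c i) *: g i =
    b *: g i0 + \sum_(i <- s) c i *: g i.
  rewrite big_cons eqxx; congr (_ + _); apply: eq_big_seq => i is_.
  by case: eqP is_ i0s => // -> ->.
have [[c c0 ->]|[l ls lx]] := IH g x us.
  left; exists (fun i => if i == i0 then 0 else c i).
    by move=> i; case: eqP.
  by rewrite sum_s scale0r add0r.
have [l0|l0] := leP 0 (linform l (g i0)).
  by right; exists l => // i; rewrite inE => /predU1P[->//|/ls].
have mul11 (y : 'rV[F]_n) (z : 'rV[F]_n) : y *m l *m z = linform l y *: z.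
  by rewrite [y *m l]mx11_scalar mul_scalar_mx.
(* the projection onto the hyperplane [l = 0] along [g i0] *)
pose P := 1%:M - (linform l (g i0))^-1 *: (l *m g i0).
have PE y : y *m P = y - (linform l y / linform l (g i0)) *: g i0.
  by rewrite mulmxBr mulmx1 -scalemxAr mulmxA mul11 scalerA mulrC.
have [[c c0 cx]|[l' ls' lx']] := IH (fun i => g i *m P) (x *m P) us.
  left; pose b := linform l x / linform l (g i0) - \sum_(i <- s) c i * (linform l (g i) / linform l (g i0)).
  exists (fun i => if i == i0 then b else c i).
    move=> i; case: eqP => // _; rewrite subr_ge0; apply: (@le_trans _ _ 0).
      rewrite big_seq; apply: sumr_le0 => j /ls lj; rewrite mulr_ge0_le0 //.
      by rewrite mulr_ge0_le0 // invr_le0 ltW.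
    by rewrite mulr_le0 // ?invr_le0 ltW.
  rewrite sum_s -[LHS](subrK ((linform l x / linform l (g i0)) *: g i0)) -PE cx addrC scalerBl.
  rewrite -addrA; congr (_ + _); rewrite [RHS]addrC scaler_suml -sumrB.
  by apply: eq_bigr => i _; rewrite PE scalerBr scalerA.
right; exists (P *m l') => [i|]; last by rewrite /linform mulmxA.
rewrite inE /linform mulmxA -/(linform _ _) => /predU1P[->|/ls'//].
by rewrite PE divff ?lt_eqF // scale1r subrr /linform mul0mx mxE.
Qed.

End Farkas.

(** * Cones, convex hulls and Minkowski sums *)

Section Cone.
Variables (K : realType) (V : lmodType K).
Implicit Types X : set V.

Lemma cone0 X : cone X 0.
Proof.
exists 0%N, (fun=> 0), (fun=> 0); split=> [[]//|//|].
by rewrite big_ord0.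
Qed.

Lemma cone_gen X x : X x -> cone X x.
Proof.
by exists 1%N, (fun=> x), (fun=> 1); split=> //; rewrite big_ord1 scale1r.
Qed.

Lemma coneD X x y : cone X x -> cone X y -> cone X (x + y).
Proof.
move=> [m [a [b [aX b0 ->]]]] [n [a' [b' [aX' b0' ->]]]].
exists (m + n)%N, (fun i => match split i with inl j => a j | inr j => a' j end),
  (fun i => match split i with inl j => b j | inr j => b' j end).
split=> [i|i|]; try by case: split.
rewrite big_split_ord /=; congr (_ + _); apply: eq_bigr => i _.
  by rewrite -[lshift _ _]/(unsplit (inl i)) unsplitK.
by rewrite -[rshift _ _]/(unsplit (inr i)) unsplitK.
Qed.

Lemma coneZ X c x : 0 <= c -> cone X x -> cone X (c *: x).
Proof.
move=> c0 [m [a [b [aX b0 ->]]]]; exists m, a, (fun i => c * b i).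
split=> // [i|]; first exact: mulr_ge0.
by rewrite scaler_sumr; apply: eq_bigr => i _; rewrite scalerA.
Qed.

Lemma cone_sum X (T : eqType) (s : seq T) (f : T -> V) :
  {in s, forall i, cone X (f i)} -> cone X (\sum_(i <- s) f i).
Proof.
move=> sX; rewrite big_seq; apply: big_ind => //; first exact: cone0.
exact: coneD.
Qed.

Lemma convex_hull_cone X x : convex_hull X x -> cone X x.
Proof. by move=> [n [a [c [? ? _ ?]]]]; exists n, a, c. Qed.

Lemma cone_sub X Y : X `<=` Y -> cone X `<=` cone Y.
Proof. by move=> XY _ [n [a [c [aX ? ->]]]]; exists n, a, c; split=> // i; apply/XY. Qed.

Lemma minkowskiA (X Y Z : set V) : X <+> Y <+> Z = X <+> (Y <+> Z).
Proof.
apply/seteqP; split=> [_ [_ [x Xx [y Yy <-]] [z Zz <-]]|_ [x Xx [_ [y Yy [z Zz <-]] <-]]].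
  by exists x => //; exists (y + z); [exists y => //; exists z|rewrite addrA].
by exists (x + y); [exists x => //; exists y|exists z => //; rewrite addrA].
Qed.

(** Combinations in [convex_hull] have arbitrarily many terms; collecting equal
points leaves one coefficient for each element of [A], so that rounding the
coefficients costs at most the cardinality of [A]. *)
Lemma convex_hull_fsetP (T : choiceType) (A : {fset T}) (f : T -> V) x :
  convex_hull [set f a | a in [set` A]] x <->
  exists2 c : T -> K, (forall a, 0 <= c a) /\ \sum_(a <- A) c a = 1
    & x = \sum_(a <- A) c a *: f a.
Proof.
split=> [[n [a [c [aA c0 c1 ->]]]]|[c [c0 c1] ->]]; last first.
  exists (size A), (fun i => f (tnth (in_tuple A) i)), (fun i => c (tnth (in_tuple A) i)).
  split=> // [i||].
  - by exists (tnth (in_tuple A) i) => //=; exact: mem_tnth.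
  - by rewrite -(big_tnth _ _ A xpredT c).
  - by rewrite -(big_tnth _ _ A xpredT (fun a => c a *: f a)).
have /choice[b bE] i : exists b : A, f (val b) = a i.
  by have [b bA <-] := aA i; exists [` bA]%fset.
pose w := fun a => if insub a is Some a' then \sum_(i | b i == a') c i else 0.
have wE (a' : A) : w (val a') = \sum_(i | b i == a') c i by rewrite /w valK.
exists w.
  split=> [a'|].
    by rewrite /w; case: insub => // a''; apply: sumr_ge0.
  rewrite big_seq_fsetE -c1 [RHS](partition_big b xpredT) //=.
  by apply: eq_bigr => a' _; rewrite wE.
rewrite big_seq_fsetE [LHS](partition_big b xpredT) //=.
apply: eq_bigr => a' _; rewrite wE scaler_suml.
by apply: eq_bigr => i /eqP <-; rewrite bE.
Qed.

End Cone.

Lemma cone_linform_ge0 (K : realType) (n : nat) (X : set 'rV[K]_n) (l : 'cV[K]_n) :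
  (forall x, X x -> 0 <= linform l x) -> forall x, cone X x -> 0 <= linform l x.
Proof.
move=> l0 _ [m [x [c [xX c0 ->]]]]; rewrite linform_sum.
by apply: sumr_ge0 => i _; rewrite linformZ mulr_ge0 // l0.
Qed.

(** * Rounding sums of real coefficients *)

Section Rounding.
Variables (K : realType) (T : eqType).

Lemma split_nat_sum (s : seq T) (m : T -> nat) n : uniq s ->
  (n <= \sum_(a <- s) m a)%N ->
  exists2 nu : T -> nat, forall a, (nu a <= m a)%N & (\sum_(a <- s) nu a = n)%N.
Proof.
elim: s n => [|a s IH] n /=.
  by rewrite big_nil leqn0 => _ /eqP ->; exists (fun=> 0%N); rewrite ?big_nil.
case/andP=> ans us; rewrite big_cons => nm.
have [|nu num nun] := IH (n - minn n (m a))%N us; first by rewrite leq_subLR; lia.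
exists (fun b => if b == a then minn n (m a) else nu b).
  by move=> b; case: eqP => // ->; apply: geq_minr.
rewrite big_cons eqxx -[RHS](subnKC (geq_minl n (m a))) -nun; congr addn.
by apply: eq_big_seq => b bs; case: eqP bs ans => // -> ->.
Qed.

(** Rounding each [mu a] down loses at most one, hence at most [size s] in
total; the resulting integers are then decreased until they sum to [n]. *)
Lemma round_down_sum (s : seq T) (mu : T -> K) n : uniq s ->
  (forall a, 0 <= mu a) -> (n + size s)%:R <= \sum_(a <- s) mu a ->
  exists2 nu : T -> nat, forall a, (nu a)%:R <= mu a & (\sum_(a <- s) nu a = n)%N.
Proof.
move=> us mu0 nmu.
have [|nu num nun] := @split_nat_sum s (fun a => Num.truncn (mu a)) n us.
  rewrite -(leq_add2r (size s)) -(ler_nat K) (le_trans nmu) //.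
  rewrite -sum1_size -big_split /= natr_sum; apply: ler_sum => a _.
  by rewrite addn1 ltW // truncnS_gt.
exists nu => // a; apply: le_trans (_ : (Num.truncn (mu a))%:R <= _).
  by rewrite ler_nat.
by rewrite truncn_le.
Qed.

End Rounding.

(** * Ideals and minimal primes *)

Section IdealGen.
Variable R : comNzRingType.
Implicit Types X : set R.

Lemma ideal_gen_ideal X : ideal (ideal_gen X).
Proof.
split=> [J [[J0 _ _] _] //|x y Xx Xy J XJ|r x Xx J XJ].
  by case: (XJ) => [[_ JD _] _]; apply: JD; [exact: Xx J XJ|exact: Xy J XJ].
by case: (XJ) => [[_ _ JM] _]; apply: JM; exact: Xx J XJ.
Qed.

Lemma sub_ideal_gen X : X `<=` ideal_gen X.
Proof. exact: sub_gen_smallest. Qed.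

Lemma ideal_sum (I : Type) (s : seq I) (P : pred I) (F : I -> R) (J : set R) :
  ideal J -> (forall i, P i -> J (F i)) -> J (\sum_(i <- s | P i) F i).
Proof. by case=> J0 JD _ JF; apply: big_ind. Qed.

End IdealGen.

Section MinimalPrimes.
Variable R : idomainType.

(** In a domain the zero ideal is the only minimal prime. *)
Lemma non_minimal_prime_neq0 (c : R) : non_minimal_prime c <-> c != 0.
Proof.
have prime0 : prime_ideal [set (0 : R)].
  split.
  - by split=> [//|x y -> ->|r x ->]; rewrite /= ?addr0 ?mulr0.
  - by move/eqP; rewrite oner_eq0.
  - by move=> x y /eqP; rewrite mulf_eq0 => /orP[] /eqP ->; [left|right].
split=> [cP|c0 P [[idP _ _] minP]].
  apply/eqP => c0; apply: (cP [set 0]) => //; split=> // Q [[Q0 _ _] _ _] Q0'.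
  by apply/seteqP; split=> // x ->.
have <- : [set 0] = P by apply: minP => // x ->; case: idP.
exact/eqP.
Qed.

End MinimalPrimes.

(** * Monomial ideals of a semigroup ring *)

Section MonomialIdeals.
Variables (k : fieldType) (d : nat) (S : addrClosed 'rV[int]_d).
Local Notation M := (submonoid S).
Local Notation R := (semigroup_ring k S).
Implicit Types (f g : R) (u v w : M) (W : set M).

Lemma monomD u v : monom k (u + v) = monom k u * monom k v :> R.
Proof. by rewrite [RHS]monalg_mulUU mulr1. Qed.

Lemma monomMn u n : monom k (u *+ n) = monom k u ^+ n :> R.
Proof. by elim: n => // n IH; rewrite mulrS exprS monomD IH. Qed.

Lemma monom_neq0 u : monom k u != 0 :> R.
Proof. by rewrite /monom monalgU_eq0 oner_eq0. Qed.

Lemma monom_supp u w : (w \in msupp (monom k u)) = (w == u).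
Proof. by rewrite /monom msuppU oner_eq0 inE. Qed.

Lemma submonoid_addI u : injective (+%R u).
Proof.
by move=> v w /(congr1 val) /(@addrI _ (val u) (val v) (val w)) /val_inj.
Qed.

Lemma supp_mul f g u : u \in msupp (f * g : R) ->
  exists2 x, x \in msupp f & exists2 y, y \in msupp g & u = x + y.
Proof.
rewrite -mcoeff_neq0 => fgu; apply: contrapT => nex; case/eqP: fgu.
rewrite [f * g]/(monalg_mul f g) /monalg_mul raddf_sum big1_seq // => x.
move=> /andP[_ xf]; rewrite raddf_sum big1_seq // => y /andP[_ yg].
rewrite /= mcoeffU; case: eqP => // xyu; case: nex.
by exists x => //; exists y.
Qed.

Lemma supp_monom_mul f u w : w \in msupp f -> u + w \in msupp (monom k u * f : R).
Proof.
move=> wf; have uu : u \in msupp (monom k u) by rewrite monom_supp.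
rewrite -mcoeff_neq0 [monom k u * f]/(monalg_mul (monom k u) f).
rewrite mcoeff_mul_unique // => [|x y].
  by rewrite mulf_neq0 // mcoeff_neq0.
by rewrite monom_supp => /eqP -> _ /submonoid_addI.
Qed.

Lemma monomial_expansion f :
  f = \sum_(u <- msupp f) (<< f@_u *g 0 >> : R) * monom k u.
Proof.
rewrite {1}(monalgE f); apply: eq_bigr => u _.
by rewrite [RHS]monalg_mulUU mulr1 add0r.
Qed.

(** A monomial ideal described by supports instead of generators, which makes
membership of a monomial a statement about exponents. *)
Definition mono_ideal W : set R :=
  [set f | forall u, u \in msupp f -> exists2 w, W w & exists s, u = w + s].

Lemma mono_ideal_ideal W : ideal (mono_ideal W).
Proof.
split=> [u|f g fW gW u|r f fW u].
- by rewrite msupp0 inE.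
- by move=> /(fsubsetP (msuppD_le f g)); rewrite inE => /orP[/fW|/gW].
- move=> /supp_mul[x _ [y /fW[w Ww [s ->]] ->]].
  by exists w => //; exists (x + s); rewrite addrCA.
Qed.

Lemma mono_ideal_monom W u :
  mono_ideal W (monom k u) <-> exists2 w, W w & exists s, u = w + s.
Proof.
split=> [|uW x]; first by apply; rewrite monom_supp.
by rewrite monom_supp => /eqP ->.
Qed.

Lemma ideal_gen_monom W :
  ideal_gen [set (monom k w : R) | w in W] = mono_ideal W.
Proof.
apply/seteqP; split.
  apply: smallest_sub; first exact: mono_ideal_ideal.
  move=> _ [w Ww <-]; apply/mono_ideal_monom; exists w => //.
  by exists 0; rewrite addr0.
move=> f fW; have idW := ideal_gen_ideal [set (monom k w : R) | w in W].
rewrite (monomial_expansion f) big_seq.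
apply: (ideal_sum _ idW) => u /fW[w Ww [s ->]].
rewrite addrC monomD mulrA; case: idW => _ _; apply.
by apply: sub_ideal_gen; exists w.
Qed.

Lemma ideal_mul_mono W W' : ideal_mul (mono_ideal W) (mono_ideal W') =
  mono_ideal [set w + w' | w in W & w' in W'].
Proof.
apply/seteqP; split.
  apply: smallest_sub; first exact: mono_ideal_ideal.
  move=> _ [x xW [y yW' <-]] u /supp_mul[u1 /xW[w Ww [s ->]]].
  move=> [u2 /yW'[w' Ww' [s' ->]] ->]; exists (w + w'); first by exists w => //; exists w'.
  by exists (s + s'); rewrite addrACA.
rewrite -ideal_gen_monom; apply: smallest_sub; first exact: ideal_gen_ideal.
move=> _ [_ [w Ww [w' Ww' <-]] <-]; rewrite monomD; apply: sub_ideal_gen.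
exists (monom k w); last exists (monom k w') => //.
  by apply/mono_ideal_monom; exists w => //; exists 0; rewrite addr0.
by apply/mono_ideal_monom; exists w' => //; exists 0; rewrite addr0.
Qed.

Definition nfold_sum W n : set M :=
  iter n (fun X => [set w + w' | w in W & w' in X]) [set 0].

Lemma ideal_pow_mono W n :
  ideal_pow (mono_ideal W) n = mono_ideal (nfold_sum W n).
Proof.
elim: n => [|n IH]; last by rewrite [LHS]/= -/(ideal_pow _ n) IH ideal_mul_mono.
by apply/seteqP; split=> // f _ u _; exists 0 => //; exists u; rewrite add0r.
Qed.

Lemma pchar_semigroup_ring p : p \in [pchar k] -> p \in [pchar R].
Proof.
rewrite !inE => /andP[-> /eqP p0]; apply/eqP.
by rewrite -[LHS](monalgUMn (0 : M) p (1 : k)) p0 monalgU0.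
Qed.

(** The [p ^ e]-th power is additive in characteristic [p], so it acts on the
expansion of an element term by term. *)
Lemma frobenius_power_mono p e W : p \in [pchar k] ->
  frobenius_power p (mono_ideal W) e = mono_ideal [set w *+ (p ^ e) | w in W].
Proof.
move=> pk; have pR := pchar_semigroup_ring pk.
have peR : [pchar R].-nat (p ^ e)%N by rewrite pnatX pnatE ?pR // (pcharf_prime pk).
apply/seteqP; split.
  apply: smallest_sub; first exact: mono_ideal_ideal.
  move=> _ [r rW <-]; rewrite (monomial_expansion r) big_seq.
  rewrite (big_morph (fun x : R => x ^+ (p ^ e)) (fun x y => exprDn_pchar x y peR)
    (expr0n _ _)).
  rewrite expn_eq0 (gtn_eqF (prime_gt0 (pcharf_prime pk))) /=.
  apply: ideal_sum => [|u /rW[w Ww [s ->]]]; first exact: mono_ideal_ideal.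
  rewrite addrC monomD mulrA exprMn -(monomMn w); case: (mono_ideal_ideal [set w *+ (p ^ e) | w in W]).
  move=> _ _; apply; apply/mono_ideal_monom.
  by exists (w *+ (p ^ e)); [exists w|exists 0; rewrite addr0].
rewrite -ideal_gen_monom; apply: smallest_sub; first exact: ideal_gen_ideal.
move=> _ [_ [w Ww <-] <-]; rewrite monomMn; apply: sub_ideal_gen.
exists (monom k w) => //.
by apply/mono_ideal_monom; exists w => //; exists 0; rewrite addr0.
Qed.

(** One monomial of [c] suffices: multiplication by monomials is injective on
exponents, so nothing cancels in [c * monom k (u + w)], and a monomial ideal
contains every monomial of each of its elements. *)
Lemma mul_sub_mono_ideal W W' (c : R) u x : x \in msupp c ->
  [set c * monom k u * y | y in mono_ideal W] `<=` mono_ideal W' ->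
  forall w, W w -> exists2 w', W' w' & exists s, x + u + w = w' + s.
Proof.
move=> xc cW w Ww; apply: (cW (c * monom k u * monom k w)).
  exists (monom k w) => //; apply/mono_ideal_monom; exists w => //.
  by exists 0; rewrite addr0.
by rewrite -mulrA -monomD mulrC -addrA [x + _]addrC; apply: supp_monom_mul.
Qed.

Lemma monom_sub_mono_ideal W W' u :
  (forall w, W w -> exists2 w', W' w' & exists s, u + w = w' + s) ->
  [set (monom k u : R) * y | y in mono_ideal W] `<=` mono_ideal W'.
Proof.
move=> uW _ [y yW <-] z /supp_mul[x + [y' /yW[w /uW[w' Ww' [s' E]] [s ->]] ->]].
rewrite monom_supp => /eqP ->; exists w' => //; exists (s' + s).
by rewrite !addrA E.
Qed.

End MonomialIdeals.

(** Listing multiplicities instead of summands is the form in which real convex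
combinations get rounded. *)
Lemma nfold_sumP (d : nat) (S : addrClosed 'rV[int]_d) (A : {fset submonoid S})
    (n : nat) (w : submonoid S) :
  nfold_sum [set` A] n w <-> exists2 nu : submonoid S -> nat,
    (\sum_(a <- A) nu a = n)%N & w = \sum_(a <- A) a *+ nu a.
Proof.
elim: n w => [|n IH] w.
  split=> [->|[nu /eqP + ->]].
    by exists (fun=> 0%N); rewrite big1.
  rewrite sum_nat_seq_eq0 => /allP nu0; rewrite big1_seq // => a /andP[_ aA].
  by rewrite (eqP (nu0 a aA)).
split=> [[a aA [_ /IH[nu nun ->] <-]]|[nu nun ->]].
  exists (fun b => (b == a) + nu b)%N.
    rewrite big_split /= nun (big_fsetD1 a) //= eqxx big1_fset ?addn0 // => b.
    by rewrite !inE => /andP[/negPf ->].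
  under [RHS]eq_bigr do rewrite mulrnDr.
  rewrite [RHS]big_split /=; congr (_ + _).
  rewrite (big_fsetD1 a) //= eqxx big1_fset ?addr0 // => b.
  by rewrite !inE => /andP[/negPf ->].
have [a aA nua] : exists2 a, a \in A & (0 < nu a)%N.
  apply: contrapT => nex; have : (\sum_(a <- A) nu a = 0)%N.
    rewrite big1_seq // => a /andP[_ aA]; apply: contrapT => /eqP.
    by rewrite -lt0n => a0; case: nex; exists a.
  by rewrite nun.
exists a => //; exists (\sum_(b <- A) b *+ (nu b - (b == a))).
  apply/IH; exists (fun b => nu b - (b == a))%N => //.
  apply/eqP; rewrite -eqSS -nun (big_fsetD1 a) //= [in eqbRHS](big_fsetD1 a) //=.
  rewrite eqxx -addSn subn1 prednK // eqn_add2l; apply/eqP.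
  by apply: eq_fbigr => b; rewrite !inE => /andP[/negPf ->]; rewrite subn0.
rewrite (big_fsetD1 a) //= [RHS](big_fsetD1 a) //= addrA -mulrS eqxx subn1 prednK //.
by congr (_ + _); apply: eq_fbigr => b; rewrite !inE => /andP[/negPf ->]; rewrite subn0.
Qed.

(** * Normality and integer points of the cone *)

Lemma generates_group_sub (V : zmodType) (S : addrClosed V) (v : V) :
  generates_group S -> exists2 s, s \in S & exists2 s', s' \in S & v = s - s'.
Proof.
move=> /(_ v)[n [s [c [sS ->]]]].
apply: (big_ind (fun v => exists2 s, s \in S & exists2 s', s' \in S & v = s - s')).
- by exists 0; rewrite ?rpred0 //; exists 0; rewrite ?rpred0 // subr0.
- move=> _ _ [x xS [x' x'S ->]] [y yS [y' y'S ->]].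
  exists (x + y); rewrite ?rpredD //; exists (x' + y'); rewrite ?rpredD //.
  by rewrite opprD addrACA.
- move=> i _; case: (c i) => m.
    by exists (s i *+ m); rewrite ?rpredMn //; exists 0; rewrite ?rpred0 // subr0.
  exists 0; rewrite ?rpred0 //; exists (s i *+ m.+1); rewrite ?rpredMn //.
  by rewrite sub0r.
Qed.

(** The fraction [a / b] is a root of the monic polynomial ['X^N - c], hence
integral. *)
Lemma normal_domain_root (R : idomainType) (a b c : R) (N : nat) :
  normal_domain R -> (0 < N)%N -> b != 0 -> a ^+ N = c * b ^+ N ->
  exists r, a = r * b.
Proof.
move=> Rnormal N0 b0 abN.
have tb0 : FracField.tofrac b != 0 by rewrite tofrac_eq0.
have [|r rE] := Rnormal (FracField.tofrac a / FracField.tofrac b).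
  exists ('X^N - c%:P); first exact: monicXnsubC.
  rewrite rmorphB /= map_polyXn map_polyC /= rootE !hornerE.
  rewrite expr_div_n -!tofracXn abN tofracM.
  by rewrite mulfK ?subrr // tofracXn expf_neq0.
by exists r; apply/eqP; rewrite -tofrac_eq tofracM -rE divfK.
Qed.

Lemma fin_gen_generators (V : nmodType) (S : addrClosed V) (G : {fset V}) :
  (forall v, v \in S <-> exists c : V -> nat, v = \sum_(g <- G) g *+ c g) ->
  forall g, g \in G -> g \in S.
Proof.
move=> SG g gG; apply/SG; exists (fun h => h == g : nat).
rewrite (big_fsetD1 g) //= eqxx big1_fset ?addr0 // => h.
by rewrite !inE => /andP[/negPf ->].
Qed.

Section Saturation.
Variables (k : fieldType) (d : nat) (S : addrClosed 'rV[int]_d).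
Hypotheses (hSgrp : generates_group S)
  (hnormal : normal_domain (semigroup_ring k S)).
Local Notation R := (semigroup_ring k S).

(** Write [z = s1 - s2] with [s1], [s2] in [S]. The fraction of the two monomials
is an [N]-th root of [monom k (z *+ N)], so by normality the monomial of [s2]
divides that of [s1] in the ring; comparing supports gives [z]. *)
Lemma normal_saturated (z : 'rV[int]_d) N : (0 < N)%N -> z *+ N \in S -> z \in S.
Proof.
move=> N0 NzS; have [s1 s1S [s2 s2S zE]] := generates_group_sub z hSgrp.
pose x u : R := monom k u; pose u1 := Submonoid s1S; pose u2 := Submonoid s2S.
pose u := Submonoid NzS.
have x12N : x u1 ^+ N = x u * x u2 ^+ N.
  have uE : u1 *+ N = u + u2 *+ N.
    apply: val_inj; rewrite raddfD !raddfMn /=.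
    by rewrite zE -mulrnDl subrK.
  by rewrite -[LHS]monomMn uE monomD [in LHS]monomMn.
have [r x1E] := normal_domain_root hnormal N0 (monom_neq0 k u2) x12N.
have : u1 \in msupp (r * x u2) by rewrite -x1E /x monom_supp.
case/supp_mul => w _ [y]; rewrite monom_supp => /eqP -> /(congr1 val) u1E.
have {}u1E : s1 = val w + s2 by [].
by rewrite zE u1E addrK; case: (w).
Qed.

Hypothesis hSfg : fin_gen_submonoid S.

(** This is the equality of [S] with the lattice points of its cone. Farkas'
lemma is applied over the rationals: it either yields rational coefficients,
whose denominators can be cleared, or a rational form that also excludes
[realify K z] from the real cone. *)
Lemma cone_saturated (K : realType) (z : 'rV[int]_d) :
  cone [set realify K u | u in [set` S]] (realify K z) -> z \in S.
Proof.
case: hSfg => G SG.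
pose rt (F : numFieldType) (u : 'rV[int]_d) : 'rV[F]_d := map_mx intr u.
have rtK (l : 'cV[rat]_d) u :
    linform (map_mx ratr l) (rt K u) = ratr (linform l (rt rat u)).
  rewrite /linform !mxE rmorph_sum; apply: eq_bigr => i _.
  by rewrite !mxE rmorphM /= ratr_int.
have [[c c0 zE] _|[l lG lz]] := farkas (rt rat) (rt rat z) (fset_uniq G).
  (* clear the denominators of the coefficients *)
  pose N := (\prod_(g <- G) `|denq (c g)|)%N.
  have N0 : (0 < N)%N.
    by rewrite prodn_gt0 // => g; rewrite absz_gt0 denq_neq0.
  have cN g : g \in G -> exists m : nat, c g * N%:R = m%:R.
    move=> gG; rewrite /N (big_fsetD1 g) //=.
    exists (`|numq (c g)| * \prod_(h <- (G `\ g)%fset) `|denq (c h)|)%N.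
    rewrite !natrM mulrA; congr (_ * _).
    rewrite !natr_absz !ger0_norm ?denq_ge0 ?numq_ge0 // ?c0 //.
    by rewrite numqE.
  apply: (normal_saturated N0); apply/SG.
  pose m g := Num.truncn (c g * N%:R).
  have mE g : g \in G -> c g * N%:R = (m g)%:R.
    by move=> /cN[i ciN]; rewrite /m ciN natrK.
  exists m; apply/rowP => j; apply: (@intr_inj rat).
  have /(congr1 (fun y : 'rV[rat]_d => N%:R * y 0 j)) := zE.
  rewrite !mxE !summxE mulr_sumr rmorph_sum /= => E.
  rewrite mulmxnE rmorphMn /= -mulr_natl E big_seq [RHS]big_seq.
  apply: eq_bigr => g gG.
  by rewrite !mxE mulmxnE rmorphMn /= -[RHS]mulr_natl -mE // mulrA [c g * _]mulrC.
(* a rational functional separating [z] from [S] also separates it from the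
   real cone *)
have lS u : u \in S -> 0 <= linform (map_mx ratr l) (rt K u).
  move=> /SG[c ->]; rewrite rtK ler0q /rt raddf_sum linform_sum big_seq.
  apply: sumr_ge0 => g gG.
  by rewrite raddfMn -scaler_nat linformZ mulr_ge0 ?ler0n //; exact: lG.
move=> /(@cone_linform_ge0 _ _ _ (map_mx ratr l)) lz0.
have : linform (map_mx ratr l) (rt K z) < 0 by rewrite rtK ltrq0.
by rewrite ltNge => /negP[]; apply: lz0 => _ [u uS <-]; apply: lS.
Qed.

End Saturation.

(** * Closedness of polyhedra along rays *)

Section RayClosed.
Variables (K : realType) (n : nat).
Local Notation V := 'rV[K]_n.
Implicit Types (P X : set V) (z u : V).

(** The only consequence of topological closedness that the limits over [e]
require, in a form that passes to finite unions and follows from separation by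
linear forms. *)
Definition ray_closed P := forall z u, ~ P z ->
  exists2 eps : K, 0 < eps & forall del, 0 <= del <= eps -> ~ P (z + del *: u).

Lemma separated_ray_closed P :
  (forall z, ~ P z -> exists (l : 'cV[K]_n) (b : K),
    (forall y, P y -> b <= linform l y) /\ linform l z < b) ->
  ray_closed P.
Proof.
move=> sepP z u /sepP[l [b [Pl zl]]].
pose m := `|linform l u|; have m0 : 0 <= m by apply: normr_ge0.
have m1 : 0 < m + 1 by rewrite ltr_wpDl.
exists ((b - linform l z) / (m + 1)) => [|del /andP[del0 +] /Pl].
  by rewrite divr_gt0 // subr_gt0.
rewrite ler_pdivlMr // linformD linformZ => delm; apply/negP; rewrite -ltNge.
have : del * linform l u <= del * m by apply: ler_wpM2l => //; apply: ler_norm.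
have [->|d0] := eqVneq del 0; first by rewrite !mul0r addr0.
have : 0 < del by rewrite lt_def d0.
by move: delm; rewrite mulrDr mulr1; lra.
Qed.

Definition fin_gen_cone X := exists2 G : {fset V},
  {in G, forall g, X g} & forall x, X x -> cone [set` G] x.

Lemma cone_ray_closed X : fin_gen_cone X -> ray_closed (cone X).
Proof.
move=> [G GX XG]; apply: separated_ray_closed => z nz.
have [[c c0 zE]|[l lG lz]] := farkas id z (fset_uniq G).
  case: nz; rewrite zE; apply: cone_sum => g gG.
  by apply: coneZ => //; apply/cone_gen/GX.
exists l, 0; split=> //; apply: cone_linform_ge0 => x /XG.
exact: cone_linform_ge0.
Qed.

(** Homogenization: [z] lies in the polyhedron exactly when [(z, 1)] lies in the
cone spanned by the [(t *: f a, 1)] and the [(g, 0)], so Farkas' lemma in one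
more dimension gives an affine form separating [z] from the polyhedron. *)
Lemma hull_cone_ray_closed (T : choiceType) (A : {fset T}) (f : T -> V) (t : K) X :
  fin_gen_cone X ->
  ray_closed (t <*:> convex_hull [set f a | a in [set` A]] <+> cone X).
Proof.
move=> [G GX XG]; apply: separated_ray_closed => z nz.
pose lift (x : V) (b : K) : 'rV_(n + 1) := row_mx x b%:M.
pose g (i : T + V) := match i with inl a => lift (t *: f a) 1 | inr y => lift y 0 end.
pose s : seq (T + V) := map inl A ++ map inr G.
have us : uniq s.
  rewrite cat_uniq !map_inj_uniq ?fset_uniq ?andbT //=; try by move=> ? ? [].
  by apply/hasPn => _ /mapP[y _ ->]; apply/mapP => -[].
have [[c c0]|[l lG]] := farkas g (lift z 1) us.
  rewrite big_cat !big_map /= => zE; case: nz.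
  (* first coordinates give the decomposition of [z], the last one the sum of
     the coefficients *)
  have := congr1 lsubmx zE; rewrite linearD !linear_sum /= row_mxKl.
  under eq_bigr do rewrite linearZ /= row_mxKl.
  under [in X in _ + X]eq_bigr do rewrite linearZ /= row_mxKl.
  move=> ->.
  have := congr1 rsubmx zE; rewrite linearD !linear_sum /= row_mxKr.
  under eq_bigr do rewrite linearZ /= row_mxKr.
  under [in X in _ + X]eq_bigr do rewrite linearZ /= row_mxKr.
  move/(congr1 (fun y : 'M_1 => y 0 0)); rewrite !mxE !summxE /=.
  rewrite [X in _ + X]big1 => [|y _]; last by rewrite !mxE mul0rn mulr0.
  under eq_bigr do rewrite !mxE mulr1n mulr1.
  rewrite addr0 mulr1n => c1.
  exists (t *: \sum_(a <- A) c (inl a) *: f a).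
    exists (\sum_(a <- A) c (inl a) *: f a) => //.
    by apply/convex_hull_fsetP; exists (fun a => c (inl a)).
  exists (\sum_(y <- G) c (inr y) *: y).
    by apply: cone_sum => y yG; apply: coneZ => //; apply/cone_gen/GX.
  congr (_ + _); rewrite scaler_sumr; apply: eq_bigr => a _.
  by rewrite !scalerA mulrC.
pose l1 := usubmx l; pose l2 := dsubmx l.
have liftE x b : linform l (lift x b) = linform l1 x + b * l2 0 0.
  by rewrite /linform /lift -{1}[l]vsubmxK mul_row_col mul_scalar_mx !mxE.
rewrite liftE mul1r => lz; exists l1, (- l2 0 0); split; last by lra.
have lA a : a \in A -> 0 <= t * linform l1 (f a) + l2 0 0.
  move=> aA; rewrite -linformZ -[l2 0 0]mul1r -liftE.
  by apply: (lG (inl a)); rewrite mem_cat map_f.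
have lX : forall x, cone X x -> 0 <= linform l1 x.
  apply: cone_linform_ge0 => x /XG; apply: cone_linform_ge0 => y yG.
  have -> : linform l1 y = linform l (lift y 0) by rewrite liftE mul0r addr0.
  by apply: (lG (inr y)); rewrite mem_cat map_f ?orbT.
move=> _ [_ [h /convex_hull_fsetP[c [c0 c1] ->] <-] [x /lX lx <-]].
rewrite linformD linformZ linform_sum mulr_sumr.
suff : 0 <= \sum_(a <- A) t * linform l1 (c a *: f a) + l2 0 0 by lra.
rewrite -[l2 0 0]mul1r -c1 mulr_suml -big_split big_seq /=.
apply: sumr_ge0 => a /lA la; rewrite linformZ mulrCA -mulrDr.
exact: mulr_ge0.
Qed.

(** A finite union of translates: take the least of the finitely many radii. *)
Lemma finite_minkowski_ray_closed (T : choiceType) (B : {fset T}) (f : T -> V) P :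
  ray_closed P -> ray_closed ([set f b | b in [set` B]] <+> P).
Proof.
move=> Pcl z u zBP.
have zP b : b \in B -> ~ P (z - f b).
  by move=> bB Pz; apply: zBP; exists (f b); [exists b|exists (z - f b); rewrite // addrC subrK].
have unif (s : seq T) : {subset s <= B} -> exists2 eps : K, 0 < eps &
    {in s, forall b del, 0 <= del <= eps -> ~ P (z - f b + del *: u)}.
  elim: s => [|b s IH] sB; first by exists 1.
  have [|e e0 eP] := IH; first by move=> x xs; apply: sB; rewrite inE xs orbT.
  have [e' e'0 e'P] := Pcl _ u (zP b (sB b (mem_head _ _))).
  exists (Num.min e e') => [|b']; first by rewrite lt_min e0.
  rewrite inE => /predU1P[-> del|bs del]; rewrite le_min => /and3P[d0 de de'].
    by apply: e'P; rewrite d0.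
  by apply: eP => //; rewrite d0.
have [eps eps0 epsP] := unif (enum_fset B) (fun _ => id).
exists eps => // del dele [_ [b bB <-] [y Py yE]]; apply: (epsP b bB del dele).
by rewrite addrAC -yE addrC addKr.
Qed.

End RayClosed.

(** * Exponents as points of the cone *)

Section Exponents.
Variables (K : realType) (d : nat) (S : addrClosed 'rV[int]_d).
Local Notation M := (submonoid S).
Implicit Types (u v w : M) (A : {fset M}) (t : K).

Local Notation r u := (realify K (val (u : M))).
Local Notation sigma := (cone [set realify K u | u in [set` S]]).
Local Notation hull A := (convex_hull [set realify K (val u) | u in [set` A]]).

Lemma realifyD u v : r (u + v) = r u + r v.
Proof. by rewrite raddfD [LHS]map_mxD. Qed.

Lemma realifyMn u n : r (u *+ n) = n%:R *: r u.
Proof. by rewrite raddfMn scaler_nat [LHS]raddfMn. Qed.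

Lemma realify_sum A (nu : M -> nat) :
  r (\sum_(a <- A) a *+ nu a) = \sum_(a <- A) (nu a)%:R *: r a.
Proof.
elim: (enum_fset A) => [|a s IH]; first by rewrite !big_nil /realify map_mx0.
by rewrite !big_cons realifyD realifyMn IH.
Qed.

Lemma realify_cone u : sigma (r u).
Proof. by apply: cone_gen; exists (val u) => //; case: u. Qed.

Lemma hull_sub_cone A : hull A `<=` sigma.
Proof.
move=> h /convex_hull_cone; apply: cone_sub => _ [a _ <-].
by exists (val a) => //; case: a.
Qed.

Lemma fin_gen_cone_realify :
  fin_gen_submonoid S -> fin_gen_cone [set realify K u | u in [set` S]].
Proof.
move=> [G SG]; exists [fset realify K g | g in G]%fset.
  move=> _ /imfsetP[g /= gG ->]; exists g => //.
  exact: fin_gen_generators SG g gG.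
move=> _ [u /SG[c ->] <-]; rewrite /realify raddf_sum; apply: cone_sum => g gG.
rewrite raddfMn -scaler_nat; apply: coneZ; first exact: ler0n.
by apply: cone_gen; apply/imfsetP; exists g.
Qed.

Lemma nfold_sum_hull A n w : (0 < n)%N -> nfold_sum [set` A] n w ->
  exists2 h, hull A h & r w = n%:R *: h.
Proof.
move=> n0 /nfold_sumP[nu nun ->].
have n0' : n%:R != 0 :> K by rewrite pnatr_eq0 -lt0n.
exists (n%:R^-1 *: r (\sum_(a <- A) a *+ nu a)); last by rewrite scalerA divff ?scale1r.
apply/convex_hull_fsetP; exists (fun a => n%:R^-1 * (nu a)%:R).
  split=> [a|]; first by rewrite mulr_ge0 ?invr_ge0 ?ler0n.
  by rewrite -mulr_sumr -natr_sum nun mulVf.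
by rewrite realify_sum scaler_sumr; apply: eq_bigr => a _; rewrite scalerA.
Qed.

(** The rounding error is a nonnegative combination of elements of [A], which the
cone absorbs. *)
Lemma round_fset_sum A (c : M -> K) n : (forall a, 0 <= c a) ->
  (n + #|` A|)%:R <= \sum_(a <- A) c a ->
  exists2 w, nfold_sum [set` A] n w & sigma (\sum_(a <- A) c a *: r a - r w).
Proof.
move=> c0 /(round_down_sum (fset_uniq A) c0)[nu nuc nun].
exists (\sum_(a <- A) a *+ nu a); first by apply/nfold_sumP; exists nu.
rewrite realify_sum -sumrB; apply: cone_sum => a aA.
rewrite -scalerBl; apply: coneZ; last exact: realify_cone.
by rewrite subr_ge0.
Qed.

Lemma round_hull A (x : K) n h : hull A h -> (n + #|` A|)%:R <= x ->
  exists2 w, nfold_sum [set` A] n w & sigma (x *: h - r w).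
Proof.
move=> /convex_hull_fsetP[c [c0 c1] ->] nx.
have x0 : 0 <= x by apply: le_trans nx; apply: ler0n.
have [a||w wA ws] := @round_fset_sum A (fun a => x * c a) n.
- exact: mulr_ge0.
- by rewrite -mulr_sumr c1 mulr1.
exists w => //; rewrite scaler_sumr.
by under eq_bigr do rewrite scalerA.
Qed.

(** When [n] may exceed [x], an extra weight of two on every element of [A] makes
up for the missing unit and for the loss in rounding: a nonempty [A] satisfies
[x + 2 * #|` A| >= n + #|` A|]. The shift does not depend on [x] or [n]. *)
Lemma round_hull_shift A (x : K) n h : hull A h -> 0 <= x -> n%:R <= x + 1 ->
  exists2 w, nfold_sum [set` A] n w &
    sigma (x *: h + r (\sum_(a <- A) a *+ 2) - r w).
Proof.
move=> /convex_hull_fsetP[c [c0 c1] ->] x0 nx.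
have A0 : (0 < #|` A|)%N.
  rewrite lt0n; apply/negP => /eqP/cardfs0_eq A0.
  by move/eqP: c1; rewrite A0 big_seq_fset0 eq_sym oner_eq0.
have A2 : \sum_(a <- A) 2 = #|` A|%:R * 2 :> K.
  by rewrite card_fset_sum1 natr_sum mulr_suml; apply: eq_bigr => a _; rewrite mul1r.
have [a||w wA ws] := @round_fset_sum A (fun a => x * c a + 2) n.
- by rewrite addr_ge0 // mulr_ge0.
- rewrite big_split /= -mulr_sumr c1 mulr1 A2 natrD.
  have : 1 <= #|` A|%:R :> K by rewrite ler1n.
  by move: nx; lra.
exists w => //; rewrite realify_sum scaler_sumr -big_split /=.
by under eq_bigr do rewrite scalerA -scalerDl.
Qed.

Section Saturated.
Variable k : fieldType.
Hypotheses (hSgrp : generates_group S) (hSfg : fin_gen_submonoid S)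
  (hnormal : normal_domain (semigroup_ring k S)).

(** Divisibility of monomials is membership of the difference of exponents in the
real cone. *)
Lemma sub_cone_dvd u w : sigma (r u - r w) -> exists s, u = w + s.
Proof.
rewrite -[_ - _]map_mxB => /(cone_saturated hSgrp hnormal hSfg) uw.
exists (Submonoid uw); apply: val_inj; rewrite raddfD /=.
by rewrite addrC subrK.
Qed.

End Saturated.

Lemma ceil_bounds t q : 0 < t ->
  t * q%:R <= `|Num.ceil (t * q%:R)|%:R <= t * q%:R + 1.
Proof.
move=> t0; have tq0 : 0 <= t * q%:R by rewrite mulr_ge0 // ltW.
rewrite natr_absz ger0_norm; last by rewrite ceil_ge0; lra.
have := ceil_itv (t * q%:R); rewrite intrB => /andP[]; lra.
Qed.

Local Notation nexp p t e := (`|Num.ceil (t * (p ^ e)%:R)|%N).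

Lemma exp_inv_small p (eps : K) : prime p -> 0 < eps ->
  exists e0, forall e, (e0 <= e)%N -> (p ^ e)%:R^-1 <= eps.
Proof.
move=> pp eps0; exists (Num.truncn eps^-1).+1 => e Ne.
rewrite -[eps]invrK lef_pV2 ?posrE ?invr_gt0 ?ltr0n ?expn_gt0 ?prime_gt0 //.
apply: (le_trans (ltW (truncnS_gt _))); rewrite ler_nat (leq_trans Ne) //.
exact/ltnW/ltn_expl/prime_gt1.
Qed.

(** For [h] in the hull, [(q * t) *: h] plus a fixed shift is an element of the
[n]-fold sumset plus an element of the cone. Adding the latter to the
hypothesis at that element gives [r v + t *: h + q^-1 *: u'] in [Q], with [u']
independent of [e]; letting [q] grow brings the point into [Q]. *)
Lemma hull_sub_of_exponents p A t (Q : set 'rV[K]_d) u v e0 :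
  prime p -> 0 < t -> ray_closed Q -> (forall x y, Q x -> sigma y -> Q (x + y)) ->
  (forall e, (e0 <= e)%N -> forall w, nfold_sum [set` A] (nexp p t e) w ->
     Q ((p ^ e)%:R^-1 *: r (u + v *+ (p ^ e) + w))) ->
  [set r v] <+> t <*:> hull A `<=` Q.
Proof.
move=> pp t0 Qcl Qs uQ _ [_ -> [_ [h hA <-] <-]].
apply: contrapT => /Qcl.
move=> /(_ (r (u + \sum_(a <- A) a *+ 2)))[eps eps0 epsQ].
have [e1 /(_ (maxn e0 e1))/(_ (leq_maxr _ _)) qeps] := exp_inv_small pp eps0.
have ee0 := leq_maxl e0 e1; set e := maxn e0 e1 in qeps ee0.
apply: (epsQ (p ^ e)%:R^-1); first by rewrite invr_ge0 ler0n.
have := ceil_bounds (p ^ e) t0; set q := (p ^ e)%N in qeps *.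
move: (uQ e ee0); rewrite -/q; set n := `|_|%N => {}uQ /andP[tqn ntq].
have q0 : 0 < q%:R :> K by rewrite ltr0n expn_gt0 prime_gt0.
have [|w wA ws] := round_hull_shift hA _ ntq; first by rewrite mulr_ge0 // ltW.
have := Qs _ _ (uQ w wA) (coneZ _ ws); move=> /(_ q%:R^-1).
rewrite invr_ge0 ltW // => /(_ isT).
congr Q; rewrite !realifyD realifyMn; set b := r (\sum_(a <- A) _).
apply/rowP => j; rewrite !mxE; field.
by rewrite gt_eqF.
Qed.

End Exponents.

(** * The four closures of a monomial ideal *)

Section ClosureInclusions.
Variables (R : idomainType) (K : realType) (p : nat) (a I : set R) (t : K).

Lemma frobenius_closure_sub_tight :
  frobenius_closure p a t I `<=` tight_closure p a t I.
Proof.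
move=> x [e0 xe]; exists 1; first exact/non_minimal_prime_neq0/oner_neq0.
by exists e0 => e /xe; under eq_imagel do rewrite -[x ^+ _]mul1r.
Qed.

Lemma left_frobenius_closure_sub_tight :
  left_frobenius_closure p a t I `<=` left_tight_closure p a t I.
Proof.
move=> x [e0 xe]; exists 1; first exact/non_minimal_prime_neq0/oner_neq0.
by exists e0 => e /xe; under eq_imagel do rewrite -[x ^+ _]mul1r.
Qed.

End ClosureInclusions.

Section Closures.
Variables (k : fieldType) (p : nat) (hp : p \in [pchar k]).
Variables (d : nat) (S : addrClosed 'rV[int]_d).
Hypotheses (hSfg : fin_gen_submonoid S) (hSgrp : generates_group S)
  (hnormal : normal_domain (semigroup_ring k S)).
Variables (K : realType) (A B : {fset submonoid S}) (t : K).
Hypothesis ht : 0 < t.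
Implicit Types v u w : submonoid S.

Local Notation R := (semigroup_ring k S).
Local Notation r u := (realify K (val (u : submonoid S))).
Local Notation sigma := (cone [set realify K u | u in [set` S]]).
Local Notation H := (convex_hull [set realify K (val u) | u in [set` A]]).
Local Notation BB := [set realify K (val b) | b in [set` B]].
Local Notation idB := (monomial_ideal k B).
Local Notation idA := (monomial_ideal k A).
Local Notation n_ e := (`|Num.ceil (t * (p ^ e)%:R)|%N).
Local Notation Asum e := (nfold_sum [set` A] (n_ e)).
Local Notation Bmul e := [set b *+ (p ^ e) | b in [set` B]].

Let p_prime : prime p := pcharf_prime hp.

Lemma real_pow_monomial e : real_pow p idA t e = mono_ideal (Asum e).
Proof. by rewrite /real_pow /monomial_ideal ideal_gen_monom ideal_pow_mono. Qed.

Lemma frobenius_power_monomial e : frobenius_power p idB e = mono_ideal (Bmul e).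
Proof. by rewrite /monomial_ideal ideal_gen_monom frobenius_power_mono. Qed.

Lemma left_power_monomial e :
  ideal_mul (real_pow p idA t e) (frobenius_power p idB e) =
  mono_ideal [set w + w' | w in Asum e & w' in Bmul e].
Proof. by rewrite real_pow_monomial frobenius_power_monomial ideal_mul_mono. Qed.

Let q_gt0 e : 0 < (p ^ e)%:R :> K.
Proof. by rewrite ltr0n expn_gt0 prime_gt0. Qed.

Let n_gt0 e : (0 < n_ e)%N.
Proof.
rewrite -(ltr_nat K); have [+ _] := andP (ceil_bounds (p ^ e) ht).
by apply: lt_le_trans; rewrite mulr_gt0.
Qed.

Let Q_absorbs (Q : set 'rV[K]_d) x y : (BB <+> (Q <+> sigma)) x -> sigma y ->
  (BB <+> (Q <+> sigma)) (x + y).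
Proof.
move=> [b bB [_ [z Qz [s ss <-]] <-]] sy; exists b => //.
exists (z + (s + y)); last by rewrite !addrA.
by exists z => //; exists (s + y) => //; apply: coneD.
Qed.

Lemma tight_hull v : tight_closure p idA t idB (monom k v) ->
  [set r v] <+> t <*:> H `<=` BB <+> sigma.
Proof.
move=> [c /non_minimal_prime_neq0/semigroup_ring_lead[u uc _] [e0 ce]].
apply: (@hull_sub_of_exponents K d S p A t _ u v e0) => //.
- exact/finite_minkowski_ray_closed/cone_ray_closed/fin_gen_cone_realify.
- move=> x y [b bB [s ss <-]] sy; exists b => //; exists (s + y); last by rewrite addrA.
  exact: coneD.
move=> e /ce; rewrite real_pow_monomial frobenius_power_monomial -monomMn.
move=> /(mul_sub_mono_ideal uc) cw w /cw[_ [b bB <-] [s ->]].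
exists (r b); first by exists b.
exists ((p ^ e)%:R^-1 *: r s).
  by apply: coneZ; [rewrite invr_ge0 ltW|apply: realify_cone].
by rewrite realifyD realifyMn scalerDr scalerA mulVf ?scale1r ?gt_eqF.
Qed.

Lemma left_tight_hull v : left_tight_closure p idA t idB (monom k v) ->
  [set r v] <+> t <*:> H `<=` BB <+> t <*:> H <+> sigma.
Proof.
rewrite minkowskiA.
move=> [c /non_minimal_prime_neq0/semigroup_ring_lead[u uc _] [e0 ce]].
apply: (@hull_sub_of_exponents K d S p A t _ u v e0) => //.
- exact/finite_minkowski_ray_closed/hull_cone_ray_closed/fin_gen_cone_realify.
- by move=> x y; apply: Q_absorbs.
move=> e /ce; rewrite real_pow_monomial frobenius_power_monomial ideal_mul_mono.
rewrite -monomMn => /(mul_sub_mono_ideal uc) cw w.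
move=> /cw[_ [w' w'A [_ [b bB <-] <-]] [s ->]].
have [h hA w'E] := nfold_sum_hull K (n_gt0 e) w'A.
have [+ _] := andP (ceil_bounds (p ^ e) ht); set n := (n_ e)%:R => tn.
(* [(n / q) *: h] is [t *: h] plus a nonnegative multiple of [h] *)
exists (r b); first by exists b.
exists (t *: h + (((n / (p ^ e)%:R) - t) *: h + (p ^ e)%:R^-1 *: r s)).
  exists (t *: h); first by exists h.
  exists (((n / (p ^ e)%:R) - t) *: h + (p ^ e)%:R^-1 *: r s) => //.
  apply: coneD.
    apply: coneZ; last exact: hull_sub_cone hA.
    by rewrite subr_ge0 ler_pdivlMr.
  by apply: coneZ; [rewrite invr_ge0 ltW|apply: realify_cone].
rewrite !realifyD realifyMn w'E -/n; apply/rowP => j; rewrite !mxE; field.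
by rewrite gt_eqF.
Qed.

(** With [w] equal to [n *: h], the point [q *: r v + r w] is [q] times
[r v + t *: h] plus [(n - q * t) *: h], and the cone contains [h]. *)
Lemma hull_frobenius v : [set r v] <+> t <*:> H `<=` BB <+> sigma ->
  frobenius_closure p idA t idB (monom k v).
Proof.
move=> vH; exists 0%N => e _.
rewrite real_pow_monomial frobenius_power_monomial -monomMn.
apply: monom_sub_mono_ideal => w wA.
have [h hA wE] := nfold_sum_hull K (n_gt0 e) wA.
have [+ _] := andP (ceil_bounds (p ^ e) ht); rewrite -subr_ge0 => tn.
have [|_ [b bB <-] [s ss bsE]] := vH (r v + t *: h).
  by exists (r v) => //; exists (t *: h) => //; exists h.
exists (b *+ (p ^ e)); first by exists b.
apply: (sub_cone_dvd hSgrp hSfg hnormal (K := K)).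
rewrite realifyD !realifyMn wE.
have := coneD (coneZ (ltW (q_gt0 e)) ss) (coneZ tn (hull_sub_cone hA)).
congr cone; rewrite (_ : r v = r b + s - t *: h); last by rewrite bsE addrK.
by apply/rowP => j; rewrite !mxE; ring.
Qed.

(** The common part of (b) and (d). The hypothesis says that [(q * s) *: h] can be
rounded down to an element of the [n]-fold sumset with the help of the
multiplier [monom k u]; that element is the factor taken from the power of the
ideal of [A]. *)
Lemma hull_left_exponents (s : K) v u e :
  (forall h, H h -> exists2 w, Asum e w & sigma (((p ^ e)%:R * s) *: h + r u - r w)) ->
  [set r v] <+> t <*:> H `<=` BB <+> s <*:> H <+> sigma ->
  [set (monom k (u + v *+ (p ^ e)) : R) * y | y in real_pow p idA t e]
    `<=` ideal_mul (real_pow p idA t e) (frobenius_power p idB e).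
Proof.
rewrite minkowskiA => uA vH; rewrite left_power_monomial real_pow_monomial.
apply: monom_sub_mono_ideal => w wA.
have [h hA wE] := nfold_sum_hull K (n_gt0 e) wA.
have [+ _] := andP (ceil_bounds (p ^ e) ht); rewrite -subr_ge0 => tn.
have [|_ [b bB <-] [_ [_ [h' h'A <-] [z sz <-]] bE]] := vH (r v + t *: h).
  by exists (r v) => //; exists (t *: h) => //; exists h.
have [w' w'A sw'] := uA h' h'A.
exists (w' + b *+ (p ^ e)); first by exists w' => //; exists (b *+ (p ^ e)) => //; exists b.
apply: (sub_cone_dvd hSgrp hSfg hnormal (K := K)).
rewrite !realifyD !realifyMn wE.
have := coneD sw' (coneD (coneZ (ltW (q_gt0 e)) sz) (coneZ tn (hull_sub_cone hA))).
congr cone; rewrite (_ : r v = r b + (s *: h' + z) - t *: h); last by rewrite bE addrK.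
by apply/rowP => j; rewrite !mxE; ring.
Qed.

Lemma hull_left_tight v :
  [set r v] <+> t <*:> H `<=` BB <+> t <*:> H <+> sigma ->
  left_tight_closure p idA t idB (monom k v).
Proof.
move=> vH; pose u : submonoid S := \sum_(a <- A) a *+ 2.
exists (monom k u); first exact/non_minimal_prime_neq0/monom_neq0.
exists 0%N => e _; rewrite -monomMn -monomD.
apply: hull_left_exponents vH => h hA.
have [_ nt] := andP (ceil_bounds (p ^ e) ht).
rewrite [_%:R * t]mulrC; apply: round_hull_shift => //.
exact/ltW/mulr_gt0.
Qed.

Lemma hull_left_frobenius v (s : K) : t < s ->
  [set r v] <+> t <*:> H `<=` BB <+> s <*:> H <+> sigma ->
  left_frobenius_closure p idA t idB (monom k v).
Proof.
move=> ts vH; have st0 : 0 < s - t by rewrite subr_gt0.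
(* chosen so that [q^-1 <= eps] gives [t * q + 1 + #|` A| <= s * q] *)
pose eps := (s - t) / (#|` A| + 1)%:R.
have [|e0 e0eps] := @exp_inv_small K p eps p_prime.
  by rewrite divr_gt0 // ltr0n addn1.
exists e0 => e /e0eps qeps; rewrite -monomMn -[_ *+ _]add0r.
apply: hull_left_exponents vH => h hA.
have [_ nt] := andP (ceil_bounds (p ^ e) ht).
have [|w wA ws] := @round_hull K d S A ((p ^ e)%:R * s) (n_ e) h hA.
  have : (#|` A| + 1)%:R <= (s - t) * (p ^ e)%:R.
    by rewrite -ler_pdivrMr // mulrC -ler_pdivlMr // ltr0n addn1.
  by rewrite natrD; move: nt; rewrite natrD; lra.
by exists w => //; move: ws; rewrite [r 0]map_mx0 addr0.
Qed.

End Closures.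

Theorem corollary6p6 (k : fieldType) (p : nat) (hp : p \in [pchar k])
    (d : nat) (S : addrClosed 'rV[int]_d)
    (hSfg : fin_gen_submonoid S) (hSgrp : generates_group S)
    (hnormal : normal_domain (semigroup_ring k S))
    (K : realType) (A B : {fset submonoid S}) (t : K) (ht : 0 < t)
    (v : submonoid S) :
  let I : set (semigroup_ring k S) := monomial_ideal k B in
  let a : set (semigroup_ring k S) := monomial_ideal k A in
  let xv : semigroup_ring k S := monom k v in
  let sigma : set 'rV[K]_d := cone [set realify K u | u in [set` S]] in
  let H : set 'rV[K]_d := convex_hull [set realify K (val u) | u in [set` A]] in
  let BB : set 'rV[K]_d := [set realify K (val b) | b in [set` B]] in
  let vv : set 'rV[K]_d := [set realify K (val v)] in
  [/\ (frobenius_closure p a t I xv <-> tight_closure p a t I xv) /\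
      (tight_closure p a t I xv <-> vv <+> t <*:> H `<=` BB <+> sigma),
      left_tight_closure p a t I xv <->
        vv <+> t <*:> H `<=` BB <+> t <*:> H <+> sigma,
      left_frobenius_closure p a t I xv ->
        vv <+> t <*:> H `<=` BB <+> t <*:> H <+> sigma
    & (exists2 s : K, t < s & vv <+> t <*:> H `<=` BB <+> s <*:> H <+> sigma) ->
        left_frobenius_closure p a t I xv].
Proof.
move=> I a xv sigma H BB vv.
split.
- split; last by split; [apply: tight_hull|move=> /hull_frobenius/frobenius_closure_sub_tight; apply].
  split; first exact: frobenius_closure_sub_tight.
  by move=> /tight_hull/hull_frobenius; apply.
- by split; [apply: left_tight_hull|apply: hull_left_tight].
- by move=> /left_frobenius_closure_sub_tight; apply: left_tight_hull.
- by move=> [s ts]; apply: hull_left_frobenius.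
Qed.
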